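(* Assume that $3\leq\kappa\leq\mu$ are cardinal numbers, $\mathbb{K}$ is a field of cardinality $\mu$ and $V$ is a linear space over $\mathbb{K}$ with $\dim V=2^\mu$. Then there is a star-like family $\mathcal{F}\subseteq V$ with $\mathcal{A}(\mathcal{F})=\kappa$ which is not $2$-lineable.
   Context: For a cardinal $\lambda$, $\lambda^+$ denotes the successor cardinal. For a vector space $V$ over a field $\mathbb{K}$ and $\mathcal{F}\subseteq V$: - $\mathcal{F}$ is star-like if $a\mathcal{F}\subseteq\mathcal{F}$ for every $a\in\mathbb{K}\setminus\{0\}$. - The additivity of $\mathcal{F}$ is the cardinal number $\mathcal{A}(\mathcal{F})=\min\big(\{|F|: F\subseteq V \text{ and } \varphi+F\nsubseteq\mathcal{F}\text{ for every }\varphi\in V\}\cup\{|V|^+\}\big)$, where $\varphi+F=\{\varphi+f:f\in F\}$. - $\mathcal{F}$ is $\lambda$-lineable (for a cardinal $\lambda$) if there is a linear subspace $W$ of $V$ with $W\subseteq\mathcal{F}\cup\{0\}$ and $\dim W=\lambda$. *)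

(* Defs.v *)
From HB Require Import structures.
From mathcomp Require Import all_boot all_order all_algebra.
From mathcomp Require Import all_classical.

Set Implicit Arguments.
Unset Strict Implicit.
Unset Printing Implicit Defensive.

Import GRing.Theory.

Local Open Scope classical_set_scope.
Local Open Scope card_scope.
Local Open Scope ring_scope.

(* A cardinal number is represented by a type of that cardinality, and a class
   of cardinals by a predicate on types; equality and order of cardinals are
   [#=] and [#<=] on full sets.  Naming the sort keeps all cardinals, in
   particular the bound ones, at a single universe level. *)
Definition cardinal := Type.

Definition card_lt (C D : cardinal) : Prop :=
  [set: C] #<= [set: D] /\ ~ ([set: D] #<= [set: C]).

(* [S] is the successor cardinal of [C]. *)
Definition card_succ (C S : cardinal) : Prop :=
  card_lt C S /\ forall U : cardinal, card_lt C U -> [set: S] #<= [set: U].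

Definition is_min_card (P : cardinal -> Prop) (C : cardinal) : Prop :=
  P C /\ forall D : cardinal, P D -> [set: C] #<= [set: D].

Section LinearSpace.
Context (K : fieldType) (V : lmodType K).

(* [c] is an arbitrary function, but only its values on [s] matter. *)
Definition lin_indep (B : set V) : Prop :=
  forall (s : seq V) (c : V -> K), uniq s -> [set` s] `<=` B ->
    \sum_(v <- s) c v *: v = 0 -> forall v, v \in s -> c v = 0.

Definition lin_span (B : set V) : set V :=
  [set x | exists (s : seq V) (c : V -> K),
     [set` s] `<=` B /\ x = \sum_(v <- s) c v *: v].

Definition hamel_basis (W B : set V) : Prop :=
  lin_indep B /\ lin_span B = W.

Definition has_dim (W : set V) (C : cardinal) : Prop :=
  exists B : set V, hamel_basis W B /\ B #= [set: C].

Definition star_like (F : set V) : Prop :=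
  forall a : K, a != 0 -> [set a *: v | v in F] `<=` F.

(* [C] is the additivity of [F]; the first alternative says that [C] is the
   cardinality of a set no translate of which is contained in [F]. *)
Definition is_additivity (F : set V) (C : cardinal) : Prop :=
  is_min_card (fun D : cardinal =>
    (exists G : set V, (forall phi : V, ~ ([set phi + g | g in G] `<=` F))
                       /\ G #= [set: D])
    \/ card_succ V D) C.

Definition lineable (C : cardinal) (F : set V) : Prop :=
  exists W : set V,
    [/\ submod_closed (mem W), W `<=` F `|` [set 0] & has_dim W C].

End LinearSpace.

(* Main.v *)
(* Take linear functionals l, m_j and w_j on V, for j in kappa, such that every
   x has w_j x <> 0 for finitely many j only, and let
     F = {x | l x <> 0 and m_j x = 0, w_i x <> 0 for some j < i},
   where < is a well-ordering of kappa all of whose initial segments have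
   cardinality less than kappa.  F is star-like, and contains no plane since
   every plane meets the kernel of l.  If F contained phi + a v for kappa many
   scalars a, where m_j v = 1, l v = 0 and w_j v = 0 for all j, then sending a
   to an index j with m_j (phi + a v) = 0 would embed kappa into the segment
   below the largest i with w_i phi <> 0; so A(F) <= kappa.  A set G of fewer
   than kappa vectors embeds into some segment {j | j < i}, and one can choose
   phi so that m_j (phi + g) = 0 for the index j assigned to g, while l and w_i
   do not vanish on phi + G because |G| < |K|.

   This needs the m_j to take prescribed values jointly.  When kappa is infinite,
   a basis of cardinality 2^mu has room for a vector for each f : kappa -> K, as
   mu * mu = mu; when kappa is finite, 2 kappa + 1 <= 2^mu basis vectors are
   enough. *)

From HB Require Import structures.
Require Import Defs.
From mathcomp Require Import all_boot all_order all_algebra.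
From mathcomp Require Import all_classical.
From mathcomp Require Import wochoice.
From Stdlib Require Import Wellfounded.

Set Implicit Arguments.
Unset Strict Implicit.
Unset Printing Implicit Defensive.

Import GRing.Theory.

Local Open Scope classical_set_scope.
Local Open Scope card_scope.

(** * Comparing cardinals by injections *)

Definition embeds (A B : Type) : Prop := exists f : A -> B, injective f.

Lemma card_le_embeds (A B : Type) : [set: A] #<= [set: B] <-> embeds A B.
Proof.
split=> [/card_leP[f]|[f f_inj]].
  exists (fun a => val (f (exist _ a (mem_set I)))) => x y /val_inj.
  by move=> /(inj (mem_set I) (mem_set I)) [].
suff: f @` [set: A] #= [set: A].
  by rewrite card_eq_le => /andP[_] /card_le_trans; apply; exact: card_leT.
by apply: inj_card_eq => x y _ _; exact: f_inj.
Qed.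

Lemma embeds_trans (A B C : Type) : embeds A B -> embeds B C -> embeds A C.
Proof. by move=> [f fI] [g gI]; exists (g \o f); exact: inj_comp. Qed.

Lemma sval_inj (T : Type) (P : T -> Prop) : injective (@sval T P).
Proof. by move=> [x px] [y py] /= exy; exact: eq_exist. Qed.

Lemma embeds_sig (A : Type) (P : A -> Prop) : embeds {x | P x} A.
Proof. by exists sval; exact: sval_inj. Qed.

Lemma embeds_prod (A B C D : Type) :
  embeds A B -> embeds C D -> embeds (A * C) (B * D).
Proof.
move=> [f fI] [g gI]; exists (fun p => (f p.1, g p.2)).
by move=> [a c] [a' c'] [/fI /= -> /gI /= ->].
Qed.

Lemma card_sig (T : Type) (A : set T) : A #= [set: {x | A x}].
Proof.
have AE : sval @` [set: {x | A x}] = A.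
  by apply/seteqP; split=> [_ [[x Ax] _ <-]//|x Ax]; exists (exist A x Ax).
have : sval @` [set: {x | A x}] #= [set: {x | A x}].
  by apply: inj_card_eq => x y _ _; exact: sval_inj.
by rewrite AE.
Qed.

Lemma card_eq_embeds (T D : Type) (A : set T) :
  A #= [set: D] -> embeds {x | A x} D /\ embeds D {x | A x}.
Proof.
move=> AD; rewrite -!card_le_embeds; apply/andP.
by rewrite -card_eq_le -(card_eql (card_sig A)).
Qed.

Lemma infinite_setP (T : Type) (A : set T) :
  infinite_set A <-> embeds nat {x | A x}.
Proof.
have := card_sig A; rewrite card_eq_le -card_le_embeds => /andP[AS SA].
split=> [/infiniteP/card_le_trans|nS]; first exact.
by apply/infiniteP; exact: card_le_trans nS SA.
Qed.

(* A map on [P] defined by well-founded recursion, taking at each point a value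
   not taken before, can only get stuck at a [p] whose predecessors exhaust
   [D]. *)
Lemma embeds_segment (P D : Type) (lt : P -> P -> Prop) :
  well_founded lt -> (forall x y, x <> y -> lt x y \/ lt y x) ->
  embeds P D \/ exists p, embeds D {q | lt q p}.
Proof.
move=> wf tot; have [|nseg] := pselect (exists p, embeds D {q | lt q p}).
  by right.
left; have fresh p (g : forall q, lt q p -> D) :
    exists d, forall q h, g q h <> d.
  apply: contrapT => nfresh; apply: nseg; exists p.
  have /choice[s sP] : forall d, exists q : {q | lt q p}, g _ (proj2_sig q) = d.
    move=> d; apply: contrapT => nd; apply: nfresh; exists d => q h gd.
    by apply: nd; exists (exist (fun q => lt q p) q h); exact: gd.
  by exists s => x y sxy; rewrite -(sP x) -(sP y) sxy.
pose step p g := sval (cid (fresh p g)).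
pose f := Fix wf (fun=> D) step.
have fE p : f p = step p (fun q _ => f q).
  rewrite /f Fix_eq // => x g g' gg'.
  suff -> : g = g' by [].
  by apply: functional_extensionality_dep => y;
     apply: functional_extensionality_dep => h.
have flt p q : lt q p -> f q <> f p.
  by move=> qp; rewrite [f p]fE; exact: (svalP (cid (fresh p _))) _ qp.
exists f => x y fxy; apply: contrapT => /tot[/flt|/flt]; first by rewrite fxy.
by rewrite fxy.
Qed.

(** * Well-orderings and squares of infinite cardinals *)

Definition well_ordering (T : Type) (lt : T -> T -> Prop) : Prop :=
  [/\ well_founded lt, (forall x y z, lt x y -> lt y z -> lt x z)
    & forall x y, x <> y -> lt x y \/ lt y x].

Lemma well_ordering_exists (T : Type) :
  exists lt : T -> T -> Prop, well_ordering lt.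
Proof.
have [R Rwo] := well_ordering_principle {classic T}.
have Rwo' : wo_chain R predT by move=> C _; exact: Rwo.
have Rtot x y : R x y \/ R y x.
  by have := wo_chainW Rwo' (x := x) (y := y) isT isT; case/orP; [left|right].
have Ras x y : R x y -> R y x -> x = y.
  by move=> xy yx; apply: (wo_chain_antisymmetric Rwo') => //; apply/andP.
pose lt x y := R x y /\ x <> y.
have lt_wf : well_founded lt.
  move=> x; apply: contrapT => nx.
  have [|z [[/asboolP zA zm] _]] := Rwo (fun y => `[< ~ Acc lt y >]).
    by exists x; exact/asboolP.
  apply: zA; constructor => y [yz nyz]; apply: contrapT => ny.
  by apply: nyz; apply: Ras => //; apply: zm; exact/asboolP.
have lt_tot x y : x <> y -> lt x y \/ lt y x.
  by move=> xy; case: (Rtot x y) => h; [left|right]; split=> // e; apply: xy.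
exists lt; split=> // x y z [xy nxy] [yz nyz].
have nacc : forall u v, lt u v -> lt v u -> False.
  by move=> u v [uv nuv] [vu _]; apply: nuv; exact: Ras.
have nxz : x <> z by move=> xz; subst z; apply: nxy; exact: Ras.
have [//|zx] := lt_tot _ _ nxz.
(* otherwise {x, y, z} has no least element *)
have [|u [[/asboolP uA um] _]] := Rwo (fun u => `[< [\/ u = x, u = y | u = z] >]).
  by exists x; apply/asboolP; constructor 1.
exfalso; case: uA => ue; subst u.
- by apply: nxz; apply: Ras; [apply: um; apply/asboolP; constructor 3|case: zx].
- by apply: nxy; apply: Ras => //; apply: um; apply/asboolP; constructor 1.
- by apply: nyz; apply: Ras => //; apply: um; apply/asboolP; constructor 2.
Qed.

Lemma well_ordering_preimage (S T : Type) (lt : T -> T -> Prop) (g : S -> T) :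
  injective g -> well_ordering lt -> well_ordering (fun x y => lt (g x) (g y)).
Proof.
move=> gI [wf tr tot]; split.
- exact: wf_inverse_image.
- by move=> x y z; exact: tr.
- by move=> x y xy; apply: tot => /gI.
Qed.

(** If [T] embeds below some point of a well-ordering, take the least such [x] and pull the order
    back along the embedding [g]: each new segment embeds below some [g a] preceding [x], so it
    cannot receive [T] by minimality. *)
Lemma initial_well_ordering (T : Type) :
  exists lt : T -> T -> Prop, well_ordering lt /\
    forall x, ~ embeds T {y | lt y x}.
Proof.
have [lt lt_wo] := well_ordering_exists T; have [wf _ _] := lt_wo.
have [[x0]|noseg] := pselect (exists x, embeds T {y | lt y x}); last first.
  by exists lt; split=> [//|x Tx]; apply: noseg; exists x.
elim: (wf x0) => {x0} x _ IH Tx.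
have [[y [yx Ty]]|nosmall] := pselect (exists y, lt y x /\ embeds T {z | lt z y}).
  exact: IH yx Ty.
have [f fI] := Tx; pose g t := sval (f t).
have gI : injective g.
  by move=> a b /sval_inj /fI.
exists (fun a b => lt (g a) (g b)); split; first exact: well_ordering_preimage.
move=> a Ta; apply: nosmall; exists (g a); split; first exact: (svalP (f a)).
apply: embeds_trans Ta _.
exists (fun b : {b | lt (g b) (g a)} =>
  exist (fun u => lt u (g a)) (g (sval b)) (svalP b)).
by move=> b c [/gI bc]; exact: sval_inj.
Qed.

(* The induction step runs through Goedel's ordering of [T * T], by maximum
   first and then lexicographically: the predecessors of a pair with maximum
   [m] lie in the square of [{y | y <= m}], which has fewer elements than
   [T]. *)
Lemma square_step (T : Type) (lt : T -> T -> Prop) : well_ordering lt ->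
  (forall x, embeds nat {y | lt y x} ->
     embeds ({y | lt y x} * {y | lt y x}) {y | lt y x}) ->
  embeds nat T -> embeds (T * T) T.
Proof.
move=> [wf tr tot] sq Tinf.
(* If [T] embeds into a segment, the hypothesis on that segment suffices; otherwise [nTx] is what
   gets contradicted below. *)
have [[x Tx]|nTx] := pselect (exists x, embeds T {y | lt y x}).
  apply: embeds_trans (embeds_prod Tx Tx) _.
  exact: embeds_trans (sq _ (embeds_trans Tinf Tx)) (embeds_sig _).
pose M (p : T * T) := if pselect (lt p.1 p.2) then p.2 else p.1.
have le_M p : (p.1 = M p \/ lt p.1 (M p)) /\ (p.2 = M p \/ lt p.2 (M p)).
  rewrite /M; case: pselect => h; first by split; [right|left].
  split; first by left.
  by have [e|/tot[]] := pselect (p.2 = p.1); [left|right|].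
pose ltM p q := lt (M p) (M q) \/ M p = M q /\
  (lt p.1 q.1 \/ p.1 = q.1 /\ lt p.2 q.2).
have ltM_wf : well_founded ltM.
  have acc m : forall a b p, M p = m -> p.1 = a -> p.2 = b -> Acc ltM p.
    elim: (wf m) => {}m _ IHm a; elim: (wf a) => {}a _ IHa b.
    elim: (wf b) => {}b _ IHb p Mp pa pb; constructor => q.
    case=> [Mqp|[Mqp [q1|[q1 q2]]]].
    - by apply: (IHm (M q)) => //; rewrite -Mp.
    - by apply: (IHa q.1) => //; [rewrite -pa|rewrite -Mp].
    - by apply: (IHb q.2) => //; [rewrite -pb|rewrite -Mp|rewrite -pa].
  by move=> p; exact: (acc (M p) p.1 p.2).
have ltM_tot p q : p <> q -> ltM p q \/ ltM q p.
  move=> pq; have [Mpq|/tot[]] := pselect (M p = M q); last 2 first.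
  - by left; left.
  - by right; left.
  have [pq1|/tot[]] := pselect (p.1 = q.1); last 2 first.
  - by left; right; split=> //; left.
  - by right; right; split=> //; left.
  have [pq2|/tot[]] := pselect (p.2 = q.2).
  - by case: pq; case: p q pq1 pq2 {Mpq} => [a b] [c d] /= -> ->.
  - by left; right; split=> //; right.
  - by right; right; split=> //; right.
have [//|[p Tp]] := embeds_segment T ltM_wf ltM_tot.
case: nTx; exists (M p).
pose J := {y | y = M p \/ lt y (M p)}.
have TJ : embeds T (J * J).
  apply: embeds_trans Tp _.
  have Mq q : ltM q p -> M q = M p \/ lt (M q) (M p) by case; [right|case; left].
  have leM x q : ltM q p -> x = M q \/ lt x (M q) -> x = M p \/ lt x (M p).
    by move=> /Mq[->//|qp] [->|xq]; right=> //; exact: tr qp.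
  exists (fun q : {q | ltM q p} =>
    (exist _ (sval q).1 (leM _ _ (svalP q) (le_M (sval q)).1),
     exist _ (sval q).2 (leM _ _ (svalP q) (le_M (sval q)).2)) : J * J).
  move=> q q' [e1 e2]; apply: sval_inj; move: e1 e2.
  by case: (sval q) (sval q') => [a b] [c d] /= -> ->.
have [I_inf|I_fin] := pselect (embeds nat {y | lt y (M p)}); last first.
  have finI : finite_set [set y | lt y (M p)].
    by apply: contrapT => I_inf; apply: I_fin; apply/infinite_setP.
  have finJ : finite_set [set: J].
    apply: contrapT => /infiniteP/card_le_embeds/infinite_setP; apply.
    suff : finite_set ([set M p] `|` [set y | lt y (M p)]) by [].
    by rewrite finite_setU; split=> //; exact: finite_set1.
  have /infiniteP : [set: nat] #<= [set: J * J].
    by apply/card_le_embeds; exact: embeds_trans TJ.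
  by case; rewrite -setXTT; exact: finite_setX.
have [h hI] := I_inf.
apply: embeds_trans TJ _; apply: embeds_trans (sq _ I_inf).
suff JI : embeds J {y | lt y (M p)} by exact: embeds_prod.
apply: embeds_trans (sq _ I_inf).
(* [J] has one point more than the segment: points below [M p] get second coordinate [h 0], which
   leaves [(h 0, h 1)] free for [M p]. *)
exists (fun y : J => if pselect (lt (sval y) (M p)) is left ly
  then (exist _ (sval y) ly, h 0) else (h 0, h 1)).
move=> [y yM] [z zM] /=; case: pselect => ly; case: pselect => lz.
- by move=> [yz]; exact: eq_exist.
- by move=> [_ /hI].
- by move=> [_ /hI].
- by move=> _; apply: eq_exist; case: yM => // ->; case: zM => // ->.
Qed.

(** Well-founded induction applies [square_step] to each segment under the restricted order; [e1]
    and [e2] identify a segment of a segment with a segment of [T]. *)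
Lemma embeds_square (T : Type) : embeds nat T -> embeds (T * T) T.
Proof.
have [lt lt_wo] := well_ordering_exists T; apply: (square_step lt_wo).
have [wf _ _] := lt_wo.
move=> x; elim: (wf x) => {}x _ IH.
apply: (square_step (well_ordering_preimage (@sval_inj _ _) lt_wo)) => -[y yx] /= I_inf.
have e1 : embeds {u : {u | lt u x} | lt (sval u) y} {u | lt u y}.
  exists (fun u : {u : {u | lt u x} | lt (sval u) y} =>
    exist (fun v => lt v y) (sval (sval u)) (svalP u)).
  by move=> u v [uv]; do 2 apply: sval_inj.
have e2 : embeds {u | lt u y} {u : {u | lt u x} | lt (sval u) y}.
  have [_ tr _] := lt_wo.
  exists (fun u : {u | lt u y} =>
    exist (fun v : {v | lt v x} => lt (sval v) y)
      (exist (fun v => lt v x) (sval u) (tr _ _ _ (svalP u) yx)) (svalP u)).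
  by move=> u v [uv]; exact: sval_inj.
apply: embeds_trans (embeds_prod e1 e1) _; apply: embeds_trans e2.
exact: IH yx (embeds_trans I_inf e1).
Qed.

(** * Linear functionals prescribed on a Hamel basis *)

Local Open Scope ring_scope.

(** Vectors may repeat in [l], so their coefficients are collected before independence applies. This
    makes the linear extension of [h] independent of the representation chosen. *)
Lemma lin_indep_comb (K : fieldType) (V : lmodType K) (B : set V) (h : V -> K)
    (l : seq (K * V)) : lin_indep B -> (forall p, p \in l -> B p.2) ->
  \sum_(p <- l) p.1 *: p.2 = 0 -> \sum_(p <- l) p.1 * h p.2 = 0.
Proof.
move=> Bi lB l0; pose s := undup [seq p.2 | p <- l].
pose c v := \sum_(p <- l | p.2 == v) p.1.
have split_sum (W : zmodType) (F : K * V -> W) :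
    \sum_(p <- l) F p = \sum_(v <- s) \sum_(p <- l | p.2 == v) F p.
  rewrite (exchange_big_dep predT) //= big_seq [RHS]big_seq.
  apply: eq_bigr => p pl.
  have ps : p.2 \in s by rewrite mem_undup map_f.
  rewrite big_mkcond (bigD1_seq p.2) ?undup_uniq //= eqxx big1 ?addr0 // => v.
  by rewrite eq_sym => /negPf ->.
have c0 v : v \in s -> c v = 0.
  apply: Bi v; first exact: undup_uniq.
    by move=> v /=; rewrite mem_undup => /mapP[p /lB pB ->].
  rewrite -[RHS]l0 split_sum; apply: eq_bigr => v _.
  by rewrite /c scaler_suml; apply: eq_bigr => p /eqP ->.
rewrite split_sum big_seq big1 // => v vs.
rewrite (eq_bigr (fun p => p.1 * h v)) => [|p /eqP -> //].
by rewrite -mulr_suml -/(c v) c0 ?mul0r.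
Qed.

(** The representation of [x] is chosen before [h], so one finite list [s] serves all [h] at once;
    this is why only finitely many coordinate functionals are nonzero at [x]. *)
Lemma hamel_extension (K : fieldType) (V : lmodType K) (B : set V) :
  hamel_basis [set: V] B ->
  exists L : (V -> K) -> {scalar V},
    (forall h v, B v -> L h v = h v) /\
    (forall x, exists s : seq V, forall h, {in s, forall v, h v = 0} -> L h x = 0).
Proof.
move=> [Bi Bspan].
have /choice[r rP] : forall x : V, exists l : seq (K * V),
    (forall p, p \in l -> B p.2) /\ x = \sum_(p <- l) p.1 *: p.2.
  move=> x; have : [set: V] x by [].
  rewrite -Bspan => -[s [c [sB ->]]]; exists [seq (c v, v) | v <- s].
  by rewrite big_map; split=> // _ /mapP[v vs ->]; exact: sB.
pose L0 (h : V -> K) x := \sum_(p <- r x) p.1 * h p.2.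
have L0E h x l : (forall p, p \in l -> B p.2) -> x = \sum_(p <- l) p.1 *: p.2 ->
    L0 h x = \sum_(p <- l) p.1 * h p.2.
  move=> lB xE; apply/eqP; rewrite -subr_eq0; apply/eqP.
  have [rB rE] := rP x.
  have := @lin_indep_comb K V B h (r x ++ [seq (- p.1, p.2) | p <- l]) Bi.
  rewrite !big_cat !big_map /= => H.
  rewrite -[RHS]H.
  - by rewrite /L0; congr (_ + _); rewrite -sumrN; apply: eq_bigr => p _; rewrite mulNr.
  - by move=> p; rewrite mem_cat => /orP[/rB//|/mapP[q /lB qB ->]].
  - rewrite -rE; under eq_bigr do rewrite scaleNr.
    by rewrite sumrN -xE subrr.
have L0_lin h : scalar (L0 h).
  move=> a x y; have [xB xE] := rP x; have [yB yE] := rP y.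
  rewrite (@L0E h _ ([seq (a * p.1, p.2) | p <- r x] ++ r y)).
  - rewrite big_cat big_map /= /L0; congr (_ + _).
    by rewrite mulr_sumr; apply: eq_bigr => p _; rewrite mulrA.
  - by move=> p; rewrite mem_cat => /orP[/mapP[q /xB qB ->]|/yB].
  - rewrite big_cat big_map /= -yE [in LHS]xE scaler_sumr; congr (_ + _).
    by apply: eq_bigr => p _; rewrite scalerA.
pose L h : {scalar V} :=
  HB.pack (L0 h) (GRing.isLinear.Build K V K *%R (L0 h) (L0_lin h)).
exists L; split.
  move=> h v Bv; rewrite /= (@L0E h v [:: (1, v)]) ?big_seq1 ?mul1r ?scale1r //.
  by move=> p; rewrite inE => /eqP ->.
move=> x; exists [seq p.2 | p <- r x] => h h0 /=.
by rewrite /L0 big_seq big1 // => p px; rewrite h0 ?mulr0 ?map_f.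
Qed.

(** * The family and its additivity *)

Lemma not_plane_lineable (K : fieldType) (V : lmodType K) (l : {scalar V})
    (F : set V) : (forall x, F x -> l x != 0) -> ~ lineable 'I_2 F.
Proof.
move=> Fl [W [_ WF [B [[Bi BW] /card_eq_embeds[_ [b bI]]]]]].
pose x := sval (b ord0); pose y := sval (b ord_max).
have Bx : B x := proj2_sig (b ord0).
have By : B y := proj2_sig (b ord_max).
have xy : x != y.
  apply/eqP => xy; have /bI : b ord0 = b ord_max by exact: sval_inj xy.
  by [].
have ker0 z : W z -> l z = 0 -> z = 0.
  by move=> /WF[/Fl/eqP//|].
have combW (a c : K) : W (a *: x + c *: y).
  rewrite -BW; exists [:: x; y], (fun v => if v == x then a else c); split.
    by move=> v /=; rewrite !inE => /orP[] /eqP ->.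
  by rewrite big_cons big_seq1 eqxx eq_sym (negPf xy).
have comb0 (a c : K) : a *: x + c *: y = 0 -> a = 0 /\ c = 0.
  move=> ac0; have := Bi [:: x; y] (fun v => if v == x then a else c).
  rewrite /= inE xy big_cons big_seq1 eqxx eq_sym (negPf xy) => /(_ isT) H.
  have {}H := H _ ac0; split.
    have := H _ x; rewrite eqxx; apply; last by rewrite inE eqxx.
    by move=> v /=; rewrite !inE => /orP[] /eqP ->.
  have := H _ y; rewrite eq_sym (negPf xy); apply; last by rewrite !inE eqxx orbT.
  by move=> v /=; rewrite !inE => /orP[] /eqP ->.
(* The combination [l y *: x - l x *: y] lies in the kernel of [l], hence vanishes; so [l y = 0],
   and then [y] itself must vanish. *)
have [ly0 _] : l y = 0 /\ - l x = 0.
  apply: comb0; apply: ker0 => //.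
  by rewrite linearD !linearZ /= mulNr [l x * _]mulrC subrr.
have : (0 : K) = 0 /\ (1 : K) = 0.
  apply: comb0; apply: ker0 => //.
  by rewrite scale0r scale1r add0r.
by move=> [_] /eqP; rewrite oner_eq0.
Qed.

(** The bad [s] are the values [- g x]; if every [s] were bad, [K], and with it [J], would embed
    into [G]. *)
Lemma avoid_values (T J : Type) (K : zmodType) (G : set T) (g : T -> K) :
  embeds J K -> ~ embeds J {x | G x} -> exists s, forall x, G x -> s + g x != 0.
Proof.
move=> JK nJG; apply: contrapT => ns; apply: nJG; apply: embeds_trans JK _.
have /choice[c cP] : forall s, exists x : {x | G x}, s = - g (sval x).
  move=> s; apply: contrapT => nx; apply: ns; exists s => x Gx.
  apply/eqP => /eqP; rewrite addr_eq0 => /eqP sx; apply: nx.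
  by exists (exist G x Gx).
by exists c => s t cst; rewrite (cP s) (cP t) cst.
Qed.

(** The vectors [ul], [uw] and [um] allow [l], a single [w i] and all [m j] together to be adjusted
    without disturbing one another. *)
Lemma cone_family (K : fieldType) (V : lmodType K) (J : Type)
    (lt : J -> J -> Prop) (l : {scalar V}) (m w : J -> {scalar V}) :
  well_ordering lt -> (forall x, ~ embeds J {y | lt y x}) ->
  J -> embeds J K ->
  (forall x, exists b, forall i, w i x != 0 -> i = b \/ lt i b) ->
  (exists u, [/\ l u = 1, forall j, m j u = 0 & forall j, w j u = 0]) ->
  (forall i, exists u, [/\ l u = 0, forall j, m j u = 0 & w i u = 1]) ->
  (forall f : J -> K,
     exists u, [/\ l u = 0, forall j, m j u = f j & forall j, w j u = 0]) ->
  exists F : set V, [/\ star_like F, is_additivity F J & ~ lineable 'I_2 F].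
Proof.
move=> [wf tr tot] initial j0 JK w_bnd [ul [lul mul wul]] uw um.
exists [set x | l x != 0 /\
  exists i j, [/\ lt j i, m j x = 0 & w i x != 0]]; split.
- move=> a a0 _ [x [lx [i [j [ji mx wx]]]] <-]; split.
    by rewrite linearZ /= mulf_neq0.
  by exists i, j; rewrite !linearZ /= mx mulr0 mulf_neq0.
- split.
    left; have [k kI] := JK; have [v [_ mv wv]] := um (fun=> 1).
    have v0 : v != 0.
      by apply/eqP => v0; have := mv j0; rewrite v0 linear0 => /eqP;
         rewrite eq_sym oner_eq0.
    exists (range (fun j => k j *: v)); split; last first.
      apply: inj_card_eq => a b _ _ /eqP; rewrite -subr_eq0 -scalerBl.
      by rewrite scaler_eq0 (negPf v0) orbF subr_eq0 => /eqP /kI.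
    (* Since every [w i] kills [v], the bound [b] for [phi] holds on the whole line [phi + a v]. *)
    move=> phi sub; have [b bP] := w_bnd phi; apply: (initial b).
    have /choice[c cP] : forall a, exists j : {j | lt j b},
        m (sval j) (phi + k a *: v) = 0.
      move=> a; have [|_ [i [j [ji mj wi]]]] := sub (phi + k a *: v).
        by exists (k a *: v) => //; exists a.
      have jb : lt j b.
        have [|<-//|ib] := bP i; last exact: tr ib.
        by move: wi; rewrite linearD linearZ /= wv mulr0 addr0.
      by exists (exist (fun j => lt j b) j jb).
    exists c => a a' caa'; apply: kI; apply: (addrI (m (sval (c a)) phi)).
    have := cP a; rewrite linearD linearZ /= mv mulr1 => ->.
    have := cP a'; rewrite -caa' linearD linearZ /= mv mulr1 => -> //.
  move=> D [[G [nG /card_eq_embeds[GD DG]]]|[[VD _] _]]; last first.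
    apply: card_le_trans VD; apply/card_le_embeds; apply: embeds_trans JK _.
    have u0 : ul != 0.
      by apply/eqP => u0; move/eqP: lul; rewrite u0 linear0 eq_sym oner_eq0.
    exists (fun a => a *: ul) => a b /eqP; rewrite -subr_eq0 -scalerBl.
    by rewrite scaler_eq0 (negPf u0) orbF subr_eq0 => /eqP.
  apply/card_le_embeds; have [//|[i Di]] := embeds_segment D wf tot.
  apply: contrapT => nJD; have nJG : ~ embeds J {x | G x}.
    by move=> /embeds_trans /(_ GD).
  have [e eI] := embeds_trans GD Di.
  (* At most one element of [G] is assigned to [j], as [e] is injective; [f j] cancels its [m j],
     and is 0 if there is none. *)
  have /choice[f fP] : forall j, exists t : K, forall x,
      sval (e x) = j -> m j (sval x) = - t.
    move=> j; have [[x xj]|nx] := pselect (exists x, sval (e x) = j).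
      exists (- m j (sval x)) => y yj; rewrite opprK; congr (m j (sval _)).
      by apply: eI; apply: sval_inj; rewrite yj.
    by exists 0 => x xj; case: nx; exists x.
  have [s sP] := avoid_values l JK nJG.
  have [t tP] := avoid_values (w i) JK nJG.
  have [p [lp mp wp]] := um f; have [q [lq mq wq]] := uw i.
  (* [p] makes the assigned [m j] vanish; [s] and [t] then move [l] and [w i] off zero, as [ul] and
     [q] are killed by all [m j]. *)
  apply: (nG (p + s *: ul + t *: q)) => _ [x Gx <-].
  pose ex := e (exist G x Gx); split; last exists i, (sval ex).
    by rewrite !linearD !linearZ /= lp lul lq mulr0 mulr1 add0r addr0 sP.
  split; first exact: (proj2_sig ex).
    rewrite !linearD !linearZ /= mp mul mq !mulr0 !addr0.
    by rewrite (fP _ (exist G x Gx) erefl) subrr.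
  by rewrite !linearD !linearZ /= wp wul wq mulr0 mulr1 !add0r tP.
- by apply: (@not_plane_lineable _ _ l) => x [].
Qed.

(** The vector at [None] carries [l], those at [inr j] carry [w j], and [e i j] is the value of
    [m j] at the vector of [inl i]. Spanning by the rows of [e] is what lets the [m j] take
    arbitrary joint values. *)
Lemma basis_family (K : fieldType) (V : lmodType K) (B : set V) (I J : Type)
    (b : option (I + J) -> V) (e : I -> J -> K) :
  hamel_basis [set: V] B -> injective b -> (forall o, B (b o)) ->
  (forall f : J -> K, exists (s : seq I) (c : I -> K),
     forall j, f j = \sum_(i <- s) c i * e i j) ->
  J -> embeds J K ->
  exists F : set V, [/\ star_like F, is_additivity F J & ~ lineable 'I_2 F].
Proof.
move=> Bb bI bB e_span j0 JK.
have [lt [lt_wo initial]] := initial_well_ordering J.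
have [L [LB Lfin]] := hamel_extension Bb.
have /choice[h hP] : forall j, exists h : V -> K,
    (forall i, h (b (Some (inl i))) = e i j) /\ h (b None) = 0 /\
    forall i, h (b (Some (inr i))) = 0.
  move=> j.
  have /choice[h hP] : forall v, exists k : K, forall o, v = b o ->
      k = if o is Some (inl i) then e i j else 0.
    move=> v; have [[o vo]|nv] := pselect (exists o, v = b o).
      exists (if o is Some (inl i) then e i j else 0) => o'.
      by rewrite vo => /bI ->.
    by exists 0 => o vo; case: nv; exists o.
  exists h; split=> [i|]; first exact: (hP _ (Some (inl i)) erefl).
  by split=> [|i]; [exact: (hP _ None erefl)|exact: (hP _ (Some (inr i)) erefl)].
pose l := L (fun v => (v == b None)%:R).
pose m j := L (h j).
pose w j := L (fun v => (v == b (Some (inr j)))%:R).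
apply: (cone_family (l := l) (m := m) (w := w) lt_wo initial j0 JK).
- move=> x; have [s sP] := Lfin x.
  (* The largest index occurring in [s], or [j0] when none occurs. *)
  have [bd bdP] : exists bd, forall j, b (Some (inr j)) \in s -> j = bd \/ lt j bd.
    have [_ tr tot] := lt_wo.
    elim: s {sP} => [|v s [bd bdP]]; first by exists j0.
    have [[i vi]|nv] := pselect (exists i, v = b (Some (inr i))); last first.
      exists bd => j; rewrite inE => /orP[/eqP jv|/bdP//].
      by case: nv; exists j.
    have [ibd|nibd] := pselect (i = bd \/ lt i bd).
      exists bd => j; rewrite inE => /orP[|/bdP//].
      by rewrite vi => /eqP/bI[->].
    exists i => j; rewrite inE => /orP[|/bdP jbd].
      by rewrite vi => /eqP/bI[->]; left.
    have /tot[|bdi] : i <> bd by move=> ?; apply: nibd; left.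
      by move=> ?; case: nibd; right.
    by right; case: jbd => [->//|jbd]; exact: tr bdi.
  exists bd => j wj; apply: bdP; apply: contraNT wj => js.
  apply/eqP; apply: sP => v vs /=; case: eqP => // vj.
  by move: js; rewrite -vj vs.
- exists (b None); split.
  + by rewrite /l LB // eqxx.
  + by move=> j; rewrite /m LB //; case: (hP j) => _ [].
  + by move=> j; rewrite /w LB //; case: eqP => // /bI.
- move=> i; exists (b (Some (inr i))); split.
  + by rewrite /l LB //; case: eqP => // /bI.
  + by move=> j; rewrite /m LB //; case: (hP j) => _ [].
  + by rewrite /w LB // eqxx.
- move=> f; have [s [c fE]] := e_span f.
  exists (\sum_(i <- s) c i *: b (Some (inl i))); split.
  + rewrite linear_sum big1 // => i _; rewrite linearZ /= /l LB //.
    by case: eqP => [/bI|_] //; rewrite mulr0.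
  + move=> j; rewrite linear_sum fE; apply: eq_bigr => i _.
    by rewrite linearZ /= /m LB //; case: (hP j) => ->.
  + move=> j; rewrite linear_sum big1 // => i _; rewrite linearZ /= /w LB //.
    by case: eqP => [/bI|_] //; rewrite mulr0.
Qed.

(** * Finding enough basis vectors *)

Lemma delta_span (K : pzRingType) (J : choiceType) (f : J -> K) :
  finite_set [set: J] ->
  exists (s : seq J) (c : J -> K), forall j, f j = \sum_(i <- s) c i * (i == j)%:R.
Proof.
move=> /finite_seqP[s sE]; exists (undup s), f => j.
have js : j \in undup s by rewrite mem_undup; have : [set: J] j by []; rewrite sE.
rewrite (bigD1_seq j) ?undup_uniq //= eqxx mulr1 big1 ?addr0 // => i.
by move=> /negPf ->; rewrite mulr0.
Qed.

(** The images are the empty set, singletons and complements of singletons. A third point separates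
    a singleton from a complement; in a two-element set they would coincide. *)
Lemma embeds_small (J M : Type) : embeds 'I_3 M -> embeds J M ->
  embeds (option (J + J)) (M -> bool).
Proof.
move=> [r rI] [k kI].
have third (a b : M) : exists z, z <> a /\ z <> b.
  apply: contrapT => nz.
  have ab z : z = a \/ z = b.
    apply: contrapT => h; apply: nz; exists z.
    by split=> zz; apply: h; [left|right].
  pose i0 : 'I_3 := ord0; pose i2 : 'I_3 := ord_max.
  pose i1 : 'I_3 := Ordinal (isT : (1 < 3)%N).
  have n01 : r i0 <> r i1 by move=> /rI.
  have n02 : r i0 <> r i2 by move=> /rI.
  have n12 : r i1 <> r i2 by move=> /rI.
  by case: (ab (r i0)) (ab (r i1)) (ab (r i2)) => e0 [] e1 [] e2; congruence.
exists (fun o z => match o with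
  | None => false
  | Some (inl j) => `[< z = k j >]
  | Some (inr j) => ~~ `[< z = k j >] end).
move=> o o' oo'; have {}oo' z := congr1 (fun f => f z) oo'.
case: o o' oo' => [[j|j]|] [[j'|j']|] //= oo'.
- by have := oo' (k j); rewrite asboolT // => /esym/asboolP/kI ->.
- have [z [zj zj']] := third (k j) (k j').
  by have := oo' z; rewrite !asboolF.
- by have := oo' (k j); rewrite asboolT.
- have [z [zj zj']] := third (k j) (k j').
  by have := oo' z; rewrite !asboolF.
- by have := oo' (k j); rewrite asboolT // => /esym/negbFE/asboolP/kI ->.
- by have [z [zj _]] := third (k j) (k j); have := oo' z; rewrite asboolF.
- by have := oo' (k j'); rewrite asboolT.
- by have [z [zj _]] := third (k j') (k j'); have := oo' z; rewrite asboolF.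
Qed.

(** Through the pairing [p], a function goes to its graph tagged by [r 0] and an index to a
    singleton tagged by [r 1]; [j0] keeps graphs apart from the empty set, the image of [None]. *)
Lemma embeds_functions (J K M : Type) : J -> embeds nat M -> embeds J M ->
  embeds K M -> embeds (option ((J -> K) + J)) (M -> bool).
Proof.
move=> j0 Minf [k kI] [i iI].
have [r rI] := Minf; have [p pI] := embeds_square Minf.
exists (fun o z => match o with
  | None => false
  | Some (inl f) => `[< exists j, z = p (r 0, p (k j, i (f j))) >]
  | Some (inr j) => `[< z = p (r 1, k j) >] end).
move=> o o' oo'; have {}oo' z := congr1 (fun f => f z) oo'.
case: o o' oo' => [[f|j]|] [[f'|j']|] //= oo'.
- congr (Some (inl _)); apply: functional_extensionality_dep => j.
  have := oo' (p (r 0, p (k j, i (f j)))); rewrite asboolT; last by exists j.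
  by move=> /esym/asboolP[j' /pI[/pI[/kI -> /iI]]].
- have := oo' (p (r 1, k j')); rewrite [RHS]asboolT // => /asboolP[j /pI[/rI]].
  by [].
- have := oo' (p (r 0, p (k j0, i (f j0)))); rewrite asboolT //.
  by exists j0.
- have := oo' (p (r 1, k j)); rewrite asboolT // => /esym/asboolP[j1 /pI[/rI]].
  by [].
- by have := oo' (p (r 1, k j)); rewrite asboolT // => /esym/asboolP/pI[/kI ->].
- by have := oo' (p (r 1, k j)); rewrite asboolT.
- have := oo' (p (r 0, p (k j0, i (f' j0)))); rewrite [RHS]asboolT //.
  by exists j0.
- by have := oo' (p (r 1, k j')); rewrite asboolT.
Qed.

Local Close Scope ring_scope.

Theorem theorem2p5 (kappa mu : cardinal)
    (h3 : [set: 'I_3] #<= [set: kappa])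
    (hkappa : [set: kappa] #<= [set: mu])
    (K : fieldType) (hK : [set: K] #= [set: mu])
    (V : lmodType K) (hV : has_dim [set: V] (mu -> bool)) :
  exists F : set V,
    [/\ star_like F, is_additivity F kappa & ~ lineable 'I_2 F].
Proof.
have [B [Bb /card_eq_embeds[_ [g gI]]]] := hV.
have /card_le_embeds k3 := h3; have [r _] := k3; pose j0 := r ord0.
have /card_le_embeds kmu := hkappa.
have [Kmu muK] : embeds K mu /\ embeds mu K.
  by rewrite -!card_le_embeds; apply/andP; rewrite -card_eq_le.
have kK := embeds_trans kmu muK.
have [k_fin|/infiniteP/card_le_embeds k_inf] := pselect (finite_set [set: kappa]).
  have [c cI] := embeds_small (embeds_trans k3 kmu) kmu.
  (* For finite [kappa] the rows are Kronecker deltas; [{classic kappa}] supplies the equality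
     test. *)
  apply: (@basis_family K V B {classic kappa} kappa (fun o => sval (g (c o)))
    (fun i j => (i == j :> {classic kappa})%:R%R)) => //.
  - by move=> o o' /sval_inj /gI /cI.
  - by move=> o; exact: (proj2_sig (g (c o))).
  - by move=> f; exact: (@delta_span _ {classic kappa}).
have [c cI] := embeds_functions j0 (embeds_trans k_inf kmu) kmu Kmu.
(* For infinite [kappa] every function is its own row. *)
apply: (@basis_family K V B (kappa -> K) kappa (fun o => sval (g (c o))) id) => //.
- by move=> o o' /sval_inj /gI /cI.
- by move=> o; exact: (proj2_sig (g (c o))).
- by move=> f; exists [:: f], (fun=> 1%R) => j; rewrite big_seq1 mul1r.
Qed.
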